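(* Suppose $\alpha+\beta=-1$. Then for every $n\ge1$, writing $\Delta=(u_3+u_4)^2-4u_1u_2$, $$2^nP_n(u_1,u_2,u_3,u_4\mid\alpha,\beta)=\sum_{k=0}^{\lfloor n/2\rfloor}\binom{n}{2k}\Delta^k(\beta-\alpha)^{n-2k}(u_3-u_4)^{n-2k}-(u_3+u_4)\sum_{k=0}^{\lfloor n/2\rfloor}\binom{n}{2k+1}\Delta^k(\beta-\alpha)^{n-2k-1}(u_3-u_4)^{n-2k-1}.$$
   Context: For $\sigma=\sigma_1\cdots\sigma_m\in\mathfrak S_m$: ${\rm LRmax}(\sigma)$ is the number of $i$ with $\sigma_j<\sigma_i$ for all $j<i$; ${\rm RLmax}(\sigma)$ is the number of $i$ with $\sigma_j<\sigma_i$ for all $j>i$. With the convention $\sigma_0=\sigma_{m+1}=0$: ${\rm W}(\sigma)$ is the number of $i\in[m]$ with $\sigma_{i-1}<\sigma_i>\sigma_{i+1}$; ${\rm V}(\sigma)$ is the number of $i$ with $1<i<m$ and $\sigma_{i-1}>\sigma_i<\sigma_{i+1}$; ${\rm rdd}(\sigma)$ is the number of $i$ with $1<i\le m$ and $\sigma_{i-1}>\sigma_i>\sigma_{i+1}$; ${\rm lda}(\sigma)$ is the number of $i$ with $1\le i<m$ and $\sigma_{i-1}<\sigma_i<\sigma_{i+1}$. Define $$P_n(u_1,u_2,u_3,u_4\mid\alpha,\beta)=\sum_{\sigma\in\mathfrak S_{n+1}}u_1^{{\rm V}(\sigma)}u_2^{{\rm W}(\sigma)-1}u_3^{{\rm rdd}(\sigma)}u_4^{{\rm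 lda}(\sigma)}\alpha^{{\rm LRmax}(\sigma)-1}\beta^{{\rm RLmax}(\sigma)-1}.$$ Convention $0^0=1$. *)

(* Defs.v *)
From mathcomp Require Import all_boot all_order all_algebra all_fingroup.
Set Implicit Arguments. Unset Strict Implicit. Unset Printing Implicit Defensive.
Import GRing.Theory.
Local Open Scope ring_scope.

(* sval s i = sigma_i (1-indexed, values in 1..m) for 1 <= i <= m, and 0 otherwise
   (convention sigma_0 = sigma_{m+1} = 0). *)
Definition sval (m : nat) (s : 'S_m) (i : nat) : nat :=
  if (1 <= i <= m)%N then nth 0%N [seq (s j : nat).+1 | j <- enum 'I_m] i.-1 else 0%N.

Definition LRmax m (s : 'S_m) : nat :=
  count (fun i => [forall j : 'I_m.+1, (1 <= j < i)%N ==> (sval s j < sval s i)%N])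
        (iota 1 m).
Definition RLmax m (s : 'S_m) : nat :=
  count (fun i => [forall j : 'I_m.+1, (i < j)%N ==> (sval s j < sval s i)%N])
        (iota 1 m).
Definition Wst m (s : 'S_m) : nat :=
  count (fun i => (sval s i.-1 < sval s i)%N && (sval s i.+1 < sval s i)%N) (iota 1 m).
Definition Vst m (s : 'S_m) : nat :=
  count (fun i => [&& (1 < i < m)%N, (sval s i < sval s i.-1)%N & (sval s i < sval s i.+1)%N])
        (iota 1 m).
Definition rdd m (s : 'S_m) : nat :=
  count (fun i => [&& (1 < i <= m)%N, (sval s i < sval s i.-1)%N & (sval s i.+1 < sval s i)%N])
        (iota 1 m).
Definition lda m (s : 'S_m) : nat :=
  count (fun i => [&& (1 <= i < m)%N, (sval s i.-1 < sval s i)%N & (sval s i < sval s i.+1)%N])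
        (iota 1 m).

Definition Pn (R : comNzRingType) (n : nat) (u1 u2 u3 u4 a b : R) : R :=
  \sum_(s : 'S_n.+1)
     u1 ^+ Vst s * u2 ^+ (Wst s).-1 * u3 ^+ rdd s * u4 ^+ lda s
     * a ^+ (LRmax s).-1 * b ^+ (RLmax s).-1.

(* Main.v *)
Require Import Defs.
From mathcomp Require Import all_boot all_order all_algebra all_fingroup.
From mathcomp Require Import ring zify.
Set Implicit Arguments. Unset Strict Implicit.
Import GRing.Theory.
Local Open Scope ring_scope.

(** Since V = W - 1, only w := u1 u2 matters. Deleting the letter 1 from a
    permutation shows that P_(n+1) = D P_n + (a u4 + b u3) P_n, where D is the
    derivation with D u3 = D u4 = w and D w = w (u3 + u4): inserting a new
    minimum at the front (end) creates a double ascent (double descent) and a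
    new LR (RL) maximum, while inserting it inside only modifies the types of
    the neighbours. Both d := u3 - u4 and c := u1 u2 - u3 u4 are killed by D, so
    one may work in R[X] with u4 = X, u3 = X + d, w = X (X + d) + c and
    D = w d/dX. When a + b = -1, the polynomial 2^n P_n = A_n - (2X + d) B_n is
    affine in X; writing s := (b - a) d and Delta := d^2 - 4 c, the
    coefficients satisfy A_(n+1) = s A_n + Delta B_n, B_(n+1) = A_n + s B_n,
    that is A_n + sqrt(Delta) B_n = (s + sqrt(Delta))^n. *)

(** * Types of letters and records in words *)

(* The type of a letter is the pair of booleans (left neighbour smaller, right
   neighbour larger); a missing right neighbour counts as smaller. *)
Fixpoint count_types (G : bool -> bool -> bool) (e : bool) (x : nat) (w : seq nat) : nat :=
  if w is y :: w' then (G e (x < y)%N + count_types G (x < y)%N y w')%N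
  else G e false.

Fixpoint rlmax (w : seq nat) : nat :=
  if w is x :: w' then (all (fun y => y < x)%N w' + rlmax w')%N else 0%N.

Definition lrmax (w : seq nat) : nat := rlmax (rev w).

Lemma rlmax_gt0 w : (0 < size w)%N -> (0 < rlmax w)%N.
Proof.
elim: w => // x [|y w] IH _ //=.
by rewrite ltn_addl //; apply: IH.
Qed.

Lemma lrmax_gt0 w : (0 < size w)%N -> (0 < lrmax w)%N.
Proof. by move=> w0; rewrite /lrmax rlmax_gt0 // size_rev. Qed.

(** The new minimum obstructs no other record and is itself one only when nothing follows it. *)
Lemma rlmax_insert0 w1 w2 : all (ltn 0) (w1 ++ w2) ->
  rlmax (w1 ++ 0%N :: w2) = (nilp w2 + rlmax (w1 ++ w2))%N.
Proof.
elim: w1 => [|x w1 IH] /=; first by case: w2.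
by case/andP=> x0 /IH ->; rewrite !all_cat /= x0 addnCA.
Qed.

Lemma lrmax_insert0 w1 w2 : all (ltn 0) (w1 ++ w2) ->
  lrmax (w1 ++ 0%N :: w2) = (nilp w1 + lrmax (w1 ++ w2))%N.
Proof.
move=> w0; rewrite /lrmax rev_cat rev_cons cat_rcons rlmax_insert0 ?rev_cat //.
  by rewrite /nilp size_rev.
by rewrite -rev_cat all_rev.
Qed.

Lemma rlmax_map_succn w : rlmax (map S w) = rlmax w.
Proof. by elim: w => //= x w ->; rewrite all_map. Qed.

Lemma lrmax_map_succn w : lrmax (map S w) = lrmax w.
Proof. by rewrite /lrmax -map_rev rlmax_map_succn. Qed.

Lemma rlmax_count w : rlmax w =
  count (fun i => all (fun y => y < nth 0 w i)%N (drop i.+1 w)) (iota 0 (size w)).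
Proof.
elim: w => //= x w ->; rewrite drop0; congr addn.
by rewrite (iotaDl 1 0) count_map.
Qed.

Lemma lrmax_count w : lrmax w =
  count (fun i => all (fun y => y < nth 0 w i)%N (take i w)) (iota 0 (size w)).
Proof.
elim/last_ind: w => // w x; rewrite /lrmax rev_rcons /= => ->.
rewrite size_rcons -addn1 iotaD count_cat addnC /= addn0 all_rev add0n.
rewrite nth_rcons ltnn eqxx -cats1 take_size_cat //.
congr addn; apply: eq_in_count => i; rewrite mem_iota add0n => /andP[_ iw].
by rewrite nth_cat iw take_cat iw.
Qed.

(** Past the end [nth] returns 0, so the last comparison is false, as the convention for a missing
    right neighbour demands. *)
Lemma count_types_nth G p x w (v := p :: x :: w) :
  count_types G (p < x)%N x w =
  count (fun i => G (nth 0 v i.-1 < nth 0 v i)%N (nth 0 v i < nth 0 v i.+1)%N)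
    (iota 1 (size w).+1).
Proof.
rewrite {}/v; elim: w p x => [|y w IH] p x; first by rewrite /= addn0.
rewrite [LHS]/= IH.
have -> : iota 1 (size (y :: w)).+1 = 1%N :: map (addn 1) (iota 1 (size w).+1).
  by rewrite -iotaDl.
rewrite -[1%N :: _]cat1s count_cat count_map; congr addn; first by rewrite /= addn0.
by apply: eq_in_count => -[|i]; rewrite mem_iota.
Qed.

(** Peaks and valleys alternate, and the descent assumed after the last letter makes the last of
    them a peak. With [e = true] the first one is a peak as well, hence the surplus. *)
Lemma peaks_valleys e x w :
  count_types (fun p q => p && ~~ q) e x w =
  (count_types (fun p q => ~~ p && q) e x w + e)%N.
Proof.
by elim: w e x => [|y w IH] e x /=; [case: e | rewrite IH; case: e; case: (x < y)%N; lia].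
Qed.

(** * Permutations as words, and their statistics *)

(* One-line notation with letters 0, ..., m - 1, unlike [Defs.sval]; the
   statistics of words below do not use the boundary value 0. *)
Definition word m (s : 'S_m) : seq nat := [seq (s j : nat) | j <- enum 'I_m].

Lemma size_word m (s : 'S_m) : size (word s) = m.
Proof. by rewrite size_map size_enum_ord. Qed.

Lemma nth_word m (s : 'S_m) (j : 'I_m) : nth 0%N (word s) j = s j.
Proof. by rewrite (nth_map j) ?size_enum_ord // nth_ord_enum. Qed.

Lemma word_uniq m (s : 'S_m) : uniq (word s).
Proof. by rewrite map_inj_uniq ?enum_uniq // => i j /val_inj /perm_inj. Qed.

Lemma sval_word m (s : 'S_m) i : Defs.sval s i = nth 0%N (0%N :: map S (word s)) i.
Proof.
case: i => [|i]; first by [].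
rewrite /Defs.sval /word.
have <- : [seq (s j : nat).+1 | j <- enum 'I_m] =
          [seq k.+1 | k <- [seq (s j : nat) | j <- enum 'I_m]].
  by rewrite -map_comp.
rewrite -[nth _ (0%N :: _) _]/(nth 0%N _ i) ltnS leq0n andTb.
case: ltnP => // h; rewrite nth_default //.
by rewrite size_map size_enum_ord.
Qed.

Lemma sval_gt0 m (s : 'S_m) i : (0 < i <= m)%N -> (0 < Defs.sval s i)%N.
Proof.
by case: i => // i im; rewrite sval_word /= (nth_map 0%N) // size_word.
Qed.

Lemma sval_oversize m (s : 'S_m) i : (m < i)%N -> Defs.sval s i = 0%N.
Proof. by move=> mi; rewrite sval_word nth_default //= size_map size_word. Qed.

Lemma sval_neq m (s : 'S_m) i : (0 < m)%N -> (i <= m)%N ->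
  Defs.sval s i != Defs.sval s i.+1.
Proof.
move=> m0; rewrite leq_eqVlt => /predU1P[->|im].
  by rewrite [Defs.sval s m.+1]sval_oversize // -lt0n sval_gt0 // m0 leqnn.
have sz: size (map S (word s)) = m by rewrite size_map size_word.
rewrite !sval_word nth_uniq.
- by rewrite neq_ltn ltnSn.
- by rewrite /= sz ltnS ltnW.
- by rewrite /= sz ltnS.
- by rewrite /= (map_inj_uniq succn_inj) word_uniq andbT; apply/mapP => -[].
Qed.

Lemma sval_gtnC m (s : 'S_m) i : (0 < m)%N -> (i <= m)%N ->
  (Defs.sval s i.+1 < Defs.sval s i)%N = ~~ (Defs.sval s i < Defs.sval s i.+1)%N.
Proof. by move=> m0 im; rewrite -leqNgt ltn_neqAle eq_sym sval_neq. Qed.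

Section Types.
Variables (m : nat) (s : 'S_m.+1).
Let x := head 0%N (word s).
Let w := behead (word s).

Lemma word_cons : word s = x :: w.
Proof. by rewrite /x /w; case: (word s) (size_word s). Qed.

Lemma count_types_sval G : count_types G true x w =
  count (fun i => G (Defs.sval s i.-1 < Defs.sval s i)%N
                    (Defs.sval s i < Defs.sval s i.+1)%N) (iota 1 m.+1).
Proof.
have E : forall e y v, count_types G e y.+1 (map S v) = count_types G e y v.
  by move=> e y v; elim: v e y => //= z v IH e y; rewrite ltnS IH.
(* Raising the letters by one puts the boundary 0 strictly below the first letter, which accounts
   for the flag [true]. *)
rewrite -E -[true]/(0 < x.+1)%N count_types_nth size_map.
have -> : (size w).+1 = m.+1 by rewrite -(size_word s) word_cons.
by apply: eq_count => i; rewrite !sval_word word_cons.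
Qed.

(** The boundary zeros force an ascent into the first position and a descent out of the last, which
    matches the range conditions in [Vst], and likewise in [rdd] and [lda]. *)
Lemma Vst_types : Vst s = count_types (fun p q => ~~ p && q) true x w.
Proof.
rewrite count_types_sval; apply: eq_in_count => -[|i]; rewrite mem_iota //= add1n => im.
rewrite sval_gtnC //; last exact: ltnW.
case: i im => [|i] im /=; first by rewrite sval_gt0.
have [h|h] /= := ltnP i.+2 m.+1; first by [].
by rewrite [Defs.sval s i.+3]sval_oversize // ltn0 andbF.
Qed.

Lemma Wst_types : Wst s = count_types (fun p q => p && ~~ q) true x w.
Proof.
rewrite count_types_sval; apply: eq_in_count => -[|i]; rewrite mem_iota //= add1n => im.
by rewrite sval_gtnC.
Qed.

Lemma rdd_types : rdd s = count_types (fun p q => ~~ p && ~~ q) true x w.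
Proof.
rewrite count_types_sval; apply: eq_in_count => -[|i]; rewrite mem_iota //= add1n => im.
rewrite !sval_gtnC //; last exact: ltnW.
case: i im => [|i] im /=; first by rewrite sval_gt0.
by rewrite -ltnS im.
Qed.

Lemma lda_types : lda s = count_types (fun p q => p && q) true x w.
Proof.
rewrite count_types_sval; apply: eq_in_count => -[|i]; rewrite mem_iota //= add1n => im.
have [h|h] /= := ltnP i.+1 m.+1; first by [].
by rewrite [Defs.sval s i.+2]sval_oversize // ltn0 andbF.
Qed.

End Types.

Lemma sval_inner m (s : 'S_m) i : (i < m)%N -> Defs.sval s i.+1 = (nth 0%N (word s) i).+1.
Proof. by move=> im; rewrite sval_word /= (nth_map 0%N) ?size_word. Qed.

Lemma RLmax_word m (s : 'S_m) : RLmax s = rlmax (word s).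
Proof.
rewrite rlmax_count size_word /RLmax (iotaDl 1 0) count_map.
apply: eq_in_count => i; rewrite mem_iota add0n => /andP[_ im] /=.
rewrite add1n sval_inner //; apply/forallP/(all_nthP 0%N).
- move=> H j; rewrite size_drop size_word => hj.
  have jm : (i.+1 + j < m)%N by lia.
  have := H (Ordinal (jm : (i.+1 + j).+1 < m.+1)%N).
  by rewrite /= sval_inner // nth_drop ltnS; move/implyP; apply; lia.
- move=> H [[|j] jm] /=; first by [].
  apply/implyP; rewrite ltnS => ij; rewrite sval_inner // ltnS.
  have := H (j - i.+1)%N; rewrite nth_drop subnKC //; apply.
  by rewrite size_drop size_word; lia.
Qed.

Lemma LRmax_word m (s : 'S_m) : LRmax s = lrmax (word s).
Proof.
rewrite lrmax_count size_word /LRmax (iotaDl 1 0) count_map.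
apply: eq_in_count => i; rewrite mem_iota add0n => /andP[_ im] /=.
have si : size (take i (word s)) = i by rewrite size_takel // size_word ltnW.
rewrite add1n sval_inner //; apply/forallP/(all_nthP 0%N).
- move=> H j; rewrite si => ji.
  have jm : (j < m)%N := ltn_trans ji im.
  have := H (Ordinal (jm : j.+1 < m.+1)%N).
  by rewrite /= sval_inner // nth_take // !ltnS; move/implyP; apply.
- move=> H [[|j] jm] /=; first by [].
  apply/implyP; rewrite ltnS => ij; rewrite sval_inner // ltnS.
  by have := H j; rewrite nth_take //; apply; rewrite si.
Qed.

(** * Insertion of a new minimum *)

Definition insert0 (i : nat) (w : seq nat) := take i w ++ 0%N :: drop i w.

Lemma word_lift_perm m (i : 'I_m.+1) (s : 'S_m) :
  word (lift_perm i ord0 s) = insert0 i (map S (word s)).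
Proof.
have szi : size (take i (map S (word s))) = i.
  by rewrite size_takel // size_map size_word -ltnS.
apply: (@eq_from_nth _ 0%N).
  by rewrite size_word size_cat szi /= size_drop size_map size_word addnS subnKC // -ltnS.
move=> j; rewrite size_word => jm; rewrite -[j]/(val (Ordinal jm)).
move: (Ordinal jm) => {jm}j; rewrite nth_word.
case: (unliftP i j) => [k|] ->; last first.
  by rewrite lift_perm_id nth_cat szi ltnn subnn.
rewrite lift_perm_lift /= /bump nth_cat szi /=.
have E : (s k).+1 = nth 0%N (map S (word s)) k.
  by rewrite (nth_map 0%N) ?size_word // nth_word.
case: (leqP i k) => ik; rewrite ?add1n ?add0n E; last by rewrite ik nth_take.
by rewrite ltnNge leqW //= subSn //= nth_drop subnKC.
Qed.

(** The position of the least value recovers [i], and the other values recover [s]; injectivity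
    suffices because both sides have [(m+1)!] elements. *)
Lemma lift_perm0_bij m :
  bijective (fun p : 'I_m.+1 * 'S_m => lift_perm p.1 ord0 p.2).
Proof.
apply: inj_card_bij; last by rewrite card_prod card_ord !card_Sn factS.
move=> [i s] [j t] /= E.
have ij : i = j.
  by apply: (@perm_inj _ (lift_perm j ord0 t)); rewrite -[in LHS]E !lift_perm_id.
rewrite -{}ij in E *; congr pair; apply/permP => k; apply: (@lift_inj _ ord0).
by rewrite -!(lift_perm_lift i) E.
Qed.

(** * Polynomial weights and the derivation recurrence *)

Section Weights.
Variables (R : comNzRingType) (d c a b : R).

Let vw : {poly R} := 'X * ('X + d%:P) + c%:P.

(* A peak gets weight 1 and a valley the weight u1 u2. *)
Definition type_weight (p q : bool) : {poly R} :=
  if p then if q then 'X else 1 else if q then vw else 'X + d%:P.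

Fixpoint types_weight (e : bool) (x : nat) (w : seq nat) : {poly R} :=
  if w is y :: w' then type_weight e (x < y)%N * types_weight (x < y)%N y w'
  else type_weight e false.

Definition word_weight (w : seq nat) : {poly R} :=
  types_weight true (head 0%N w) (behead w)
  * (a ^+ (lrmax w).-1 * b ^+ (rlmax w).-1)%:P.

Lemma types_weight_map_succn e x w :
  types_weight e x.+1 (map S w) = types_weight e x w.
Proof. by elim: w e x => //= y w IH e x; rewrite ltnS IH. Qed.

Lemma word_weight_map_succn w : (0 < size w)%N -> word_weight (map S w) = word_weight w.
Proof.
case: w => // x w _.
by rewrite /word_weight lrmax_map_succn rlmax_map_succn types_weight_map_succn.
Qed.

Lemma deriv_type_weight p q : (type_weight p q)^`() =
  if p then if q then 1 else 0 else if q then 'X *+ 2 + d%:P else 1.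
Proof.
rewrite /type_weight /vw; case: p; case: q.
- by rewrite derivX.
- by rewrite -[1]/(1%:P) derivC.
- rewrite derivD derivM derivD derivX !derivC; ring.
- by rewrite derivD derivX derivC addr0.
Qed.

(* Inserting 0 into a descent or an ascent x, y changes one neighbour's type; the
   correction term, for e = false, is the insertion into the descent just
   before x, which the derivative counts but the sum does not. *)
Lemma types_weight_insert0_inner e x w : all (ltn 0) w ->
  \sum_(i < size w) types_weight e x (insert0 i w) =
  vw * (types_weight e x w)^`() - (if e then 0 else vw * types_weight true x w).
Proof.
elim: w e x => [|y w IH] e x /=.
  by move=> _; rewrite big_ord0 deriv_type_weight; case: e => /=; ring.
case/andP=> y0 w0; rewrite big_ord_recl /= y0 ltn0.
rewrite -big_distrr [X in _ + _ * X]IH // derivM deriv_type_weight.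
(* If [x < y], the gap before [y] supplies the derivative of the weight of [x], up to the correction
   for [e = false]. If [x > y], it cancels the correction from the induction hypothesis. *)
by case: e; case: (x < y)%N => /=; rewrite /vw; ring.
Qed.

Lemma types_weight_rcons0 e x w :
  types_weight e x (rcons w 0%N) = types_weight e x w * type_weight false false.
Proof. by elim: w e x => [|y w IH] e x /=; rewrite ?ltn0 // IH mulrA. Qed.

Lemma word_weight_insert0 w : (0 < size w)%N -> all (ltn 0) w ->
  \sum_(i < (size w).+1) word_weight (insert0 i w) =
  vw * (word_weight w)^`() + (a%:P * 'X + b%:P * ('X + d%:P)) * word_weight w.
Proof.
case: w => // x w _ w0; set v := x :: w.
have lr0 := @lrmax_gt0 v isT; have rl0 := @rlmax_gt0 v isT.
have lrE i : (i <= size v)%N -> lrmax (insert0 i v) = ((i == 0%N) + lrmax v)%N.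
  by move=> iv; rewrite lrmax_insert0 cat_take_drop // /nilp size_takel.
have rlE i : (i <= size v)%N -> rlmax (insert0 i v) = ((i == size v) + rlmax v)%N.
  move=> iv; rewrite rlmax_insert0 cat_take_drop // /nilp size_drop subn_eq0.
  by rewrite eqn_leq iv.
set K := (a ^+ (lrmax v).-1 * b ^+ (rlmax v).-1)%:P.
set t := types_weight true x w.
have first_gap : word_weight (insert0 0 v) = a%:P * 'X * (t * K).
  have x0 : (0 < x)%N by case/andP: w0.
  (* Since [lrmax v] is positive, the truncated predecessor in the exponent really grows by one. *)
  rewrite /word_weight lrE // rlE // !add0n -{1}(prednK lr0) /= x0 -/t exprS.
  by rewrite -mulrA polyCM -/K; ring.
have inner_gap (i : 'I_(size w)) :
    word_weight (insert0 i.+1 v) = types_weight true x (insert0 i w) * K.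
  have iv : (i.+1 < (size v))%N by rewrite ltnS.
  by rewrite /word_weight lrE ?rlE 1?ltnW // (ltn_eqF iv).
have last_gap : word_weight (insert0 (size v) v) = b%:P * ('X + d%:P) * (t * K).
  rewrite /word_weight lrE // rlE // eqxx -{1}(prednK rl0) /insert0.
  rewrite take_size drop_size cats1 /= types_weight_rcons0 -/t exprS /=.
  by rewrite mulrCA polyCM -/K; ring.
have -> : \sum_(i < (size v).+1) word_weight (insert0 i v) =
    word_weight (insert0 0 v) + \sum_(i < size w) word_weight (insert0 i.+1 v)
    + word_weight (insert0 (size v) v).
  by rewrite big_ord_recr big_ord_recl.
rewrite first_gap last_gap (eq_bigr _ (fun i _ => inner_gap i)) -big_distrl /=.
rewrite types_weight_insert0_inner; last by case/andP: w0.
rewrite /word_weight -/K -/t derivM derivC; ring.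
Qed.

Definition word_poly (n : nat) : {poly R} := \sum_(s : 'S_n.+1) word_weight (word s).

Lemma word_poly0 : word_poly 0 = 1.
Proof.
rewrite /word_poly (eq_bigr (fun=> 1)) => [|s _].
  by rewrite sumr_const card_Sn.
rewrite /word_weight; case: (word s) (size_word s) => [|x [|//]] // _.
by rewrite /lrmax /= !expr0 !mulr1.
Qed.

Lemma word_polyS n : word_poly n.+1 =
  vw * (word_poly n)^`() + (a%:P * 'X + b%:P * ('X + d%:P)) * word_poly n.
Proof.
rewrite /word_poly (reindex _ (onW_bij _ (@lift_perm0_bij n.+1))) /=.
rewrite -(pair_big xpredT xpredT (fun i s => word_weight (word (lift_perm i ord0 s)))) /=.
rewrite exchange_big linear_sum !big_distrr -big_split /=; apply: eq_bigr => s _.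
have sz : size (map S (word s)) = n.+1 by rewrite size_map size_word.
(* Raising all letters by one frees the value 0 and preserves the weight. *)
rewrite -word_weight_map_succn ?size_word // -word_weight_insert0 ?sz //.
  by apply: eq_bigr => i _; rewrite word_lift_perm.
by rewrite all_map; apply/allP.
Qed.

End Weights.

(** At [X = u4] the weights [X + d] and [vw] become [u3] and [u1 * u2]; as W - 1 = V, the powers of
    [u1] and [u2] merge into one power of [u1 * u2]. *)
Lemma word_weight_horner (R : comNzRingType) (u1 u2 u3 u4 a b : R) n (s : 'S_n.+1) :
  (word_weight (u3 - u4) (u1 * u2 - u3 * u4) a b (word s)).[u4] =
  u1 ^+ Vst s * u2 ^+ (Wst s).-1 * u3 ^+ rdd s * u4 ^+ lda s
     * a ^+ (LRmax s).-1 * b ^+ (RLmax s).-1.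
Proof.
rewrite RLmax_word LRmax_word Vst_types Wst_types rdd_types lda_types.
rewrite peaks_valleys addn1 /= /word_weight hornerM hornerC mulrA; congr (_ * _ * _).
rewrite -exprMn.
elim: (behead _) true (head _ _) => [|y w IH] e x.
  by case: e => /=; rewrite /type_weight !hornerE /=; ring.
rewrite /= hornerM {}IH !exprD !mulrA; case: e; case: (x < y)%N => /=.
all: by rewrite /type_weight !hornerE /=; ring.
Qed.

Lemma Pn_word_poly (R : comNzRingType) (u1 u2 u3 u4 a b : R) n :
  Pn n u1 u2 u3 u4 a b = (word_poly (u3 - u4) (u1 * u2 - u3 * u4) a b n).[u4].
Proof.
rewrite /word_poly horner_sum; apply: eq_bigr => s _.
by rewrite word_weight_horner.
Qed.

(** * Binomial sums and their recurrences *)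

Definition even_sum (R : comNzRingType) (D s : R) n :=
  \sum_(k < (n./2).+1) 'C(n, 2 * k)%:R * D ^+ k * s ^+ (n - 2 * k).
Definition odd_sum (R : comNzRingType) (D s : R) n :=
  \sum_(k < (n./2).+1) 'C(n, 2 * k + 1)%:R * D ^+ k * s ^+ (n - 2 * k - 1).

(** Lets the sums for [n] and [n.+1] share one index range, so that Pascal's rule applies term by
    term. *)
Lemma widen_half_sum (R : comNzRingType) (F : nat -> R) n m : (n./2 < m)%N ->
  (forall k, (n < 2 * k)%N -> F k = 0) -> \sum_(k < (n./2).+1) F k = \sum_(k < m) F k.
Proof.
move=> nm F0; rewrite -!(big_mkord xpredT) (big_cat_nat _ nm) //=.
rewrite [X in _ + X]big_nat_cond [X in _ + X]big1 ?addr0 // => k.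
by rewrite andbT => /andP[hk _]; apply: F0; lia.
Qed.

Section Sums.
Variables (R : comNzRingType) (D s : R).

Lemma even_sum_widen n m : (n./2 < m)%N ->
  even_sum D s n = \sum_(k < m) 'C(n, 2 * k)%:R * D ^+ k * s ^+ (n - 2 * k).
Proof.
move=> nm; apply: (widen_half_sum 
    (F := fun k => 'C(n, 2 * k)%:R * D ^+ k * s ^+ (n - 2 * k))) => //.
by move=> k nk; rewrite bin_small // !mul0r.
Qed.

Lemma odd_sum_widen n m : (n./2 < m)%N ->
  odd_sum D s n = \sum_(k < m) 'C(n, 2 * k + 1)%:R * D ^+ k * s ^+ (n - 2 * k - 1).
Proof.
move=> nm; apply: (widen_half_sum 
    (F := fun k => 'C(n, 2 * k + 1)%:R * D ^+ k * s ^+ (n - 2 * k - 1))) => //.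
by move=> k nk; rewrite bin_small ?mul0r // addn1 ltnW.
Qed.

Lemma odd_sumS n : odd_sum D s n.+1 = even_sum D s n + s * odd_sum D s n.
Proof.
rewrite (@odd_sum_widen _ n.+1) ?(@odd_sum_widen _ n.+1) ?(@even_sum_widen _ n.+1); try lia.
rewrite big_distrr -big_split /=; apply: eq_bigr => k _.
rewrite addn1 binS natrD.
have [kn|nk] := ltnP (2 * k) n.
  have -> : (n.+1 - 2 * k - 1 = n - 2 * k)%N by lia.
  by rewrite -(subnSK kn) subnS subn1 exprS; ring.
(* Here [n <= 2 * k]: the vanishing binomial removes the term whose exponent is truncated. *)
rewrite (@bin_small n (2 * k).+1) //.
have -> : (n.+1 - 2 * k - 1 = n - 2 * k)%N by lia.
by ring.
Qed.

Lemma even_sumS n : even_sum D s n.+1 = s * even_sum D s n + D * odd_sum D s n.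
Proof.
rewrite (@even_sum_widen _ n.+2) ?(@even_sum_widen _ n.+2) ?(@odd_sum_widen _ n.+1); try lia.
(* Splitting off [k = 0] aligns index [k.+1] of the even sums with index [k] of the odd sum, which
   gains a factor [D]. *)
rewrite big_ord_recl [in RHS]big_ord_recl !muln0 !bin0 !subn0 mulrDr -addrA.
rewrite !big_distrr -big_split /=.
congr (_ + _); first by rewrite exprS; ring.
apply: eq_bigr => k _; rewrite /bump leq0n add1n.
have -> : (2 * k.+1 = (2 * k).+2)%N by lia.
rewrite addn1 binS natrD exprS.
have [kn|nk] := ltnP (2 * k).+1 n.
  have -> : (n.+1 - (2 * k).+2 = (n - (2 * k).+2).+1)%N by lia.
  have -> : (n - 2 * k - 1 = (n - (2 * k).+2).+1)%N by lia.
  by rewrite exprS; ring.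
rewrite (@bin_small n (2 * k).+2) //.
have -> : (n.+1 - (2 * k).+2 = n - 2 * k - 1)%N by lia.
by ring.
Qed.
End Sums.

(** * Closed form and conclusion *)

Lemma word_poly_closed (R : comNzRingType) (d c a b : R) n : a + b = -1 ->
  let D := d ^+ 2 - 4%:R * c in let s := (b - a) * d in
  2%:R ^+ n * word_poly d c a b n =
  (even_sum D s n)%:P - ('X *+ 2 + d%:P) * (odd_sum D s n)%:P.
Proof.
move=> ab D s; elim: n => [|n IH].
  rewrite word_poly0 /even_sum /odd_sum !big_ord1 !muln0 subn0 !expr0 bin0 bin_small //.
  by rewrite !mulr1 polyC0 mulr0 subr0.
rewrite word_polyS even_sumS odd_sumS.
have a_b : a = - 1 - b by rewrite -ab addrK.
set A := even_sum D s n; set B := odd_sum D s n.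
(* In [R] one cannot divide by 2, so the derivative too is known only after multiplication by the
   constant [2 ^ n]. *)
have dIH : 2%:R ^+ n * (word_poly d c a b n)^`() = - (B%:P *+ 2).
  have -> : 2%:R ^+ n * (word_poly d c a b n)^`() = (2%:R ^+ n * word_poly d c a b n)^`().
    have -> : 2%:R ^+ n = (2%:R ^+ n)%:P :> {poly R} by rewrite rmorphXn /= rmorph_nat.
    by rewrite derivM derivC mul0r add0r.
  rewrite IH derivB derivM derivD derivMn derivX !derivC; ring.
rewrite exprS -mulrA mulrDr [2%:R ^+ n * (_ * _^`())]mulrCA dIH.
rewrite [2%:R ^+ n * (_ * word_poly _ _ _ _ _)]mulrCA IH -/A -/B /D /s a_b.
(* With [y = 2X + d], one has [4 vw = y^2 - D] and, as [a + b = -1], [2 (a X + b (X + d)) = s - y];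
   the terms in [y^2] cancel. *)
rewrite !(polyCD, polyCN, polyCM); ring.
Qed.

Theorem theorem5p1 (R : comNzRingType) (u1 u2 u3 u4 a b : R) (n : nat) :
  a + b = -1 -> (1 <= n)%N ->
  let D := (u3 + u4) ^+ 2 - 4%:R * u1 * u2 in
  2%:R ^+ n * Pn n u1 u2 u3 u4 a b =
    \sum_(k < (n./2).+1)
       'C(n, 2 * k)%:R * D ^+ k * (b - a) ^+ (n - 2 * k) * (u3 - u4) ^+ (n - 2 * k)
  - (u3 + u4) *
    \sum_(k < (n./2).+1)
       'C(n, 2 * k + 1)%:R * D ^+ k * (b - a) ^+ (n - 2 * k - 1)
         * (u3 - u4) ^+ (n - 2 * k - 1).
Proof.
move=> ab _ D; rewrite Pn_word_poly.
have := word_poly_closed (u3 - u4) (u1 * u2 - u3 * u4) n ab.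
have -> : (u3 - u4) ^+ 2 - 4%:R * (u1 * u2 - u3 * u4) = D by rewrite /D; ring.
(* Evaluation at [u4] turns [2X + d] into [u3 + u4]. *)
move=> /(congr1 (horner^~ u4)); rewrite !hornerE -[1 + 1]/(2%:R) => ->.
congr (_ - _ * _); last 1 first.
- by apply: eq_bigr => k _; rewrite exprMn mulrA.
- by apply: eq_bigr => k _; rewrite exprMn mulrA.
- by rewrite /=; ring.
Qed.
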